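(* Let $S=\langle Ax, R\rangle$ be a deductive system and let $R_b$ be a relative to $S$ base of admissible rules. Then the structural completion $\widetilde{S}$ of $S$ is hereditarily structurally complete if and only if, for every deductive extension $S'$ of $S$ in which all rules of $R_b$ are admissible, $R_b$ is a relative to $S'$ base of admissible rules.
   Context: A propositional language is a finite set of connectives with finite arities; formulas are built from a countably infinite set of variables. A substitution is a map from variables to formulas, extended to formulas and sets of formulas. A rule is a pair $\Gamma/A$ with $\Gamma$ a finite (possibly empty) set of formulas and $A$ a formula; its substitution instances are $\sigma(\Gamma)/\sigma(A)$. A deductive system is a pair $S=\langle Ax,R\rangle$ with $Ax$ a nonempty set of formulas and $R$ a nonempty set of rules. For finite $\Gamma$, $\Gamma\vdash_S A$ means there is a sequence $B_1,\dots,B_n=A$ where each $B_i$ is in $\Gamma$, or is a substitution instance of a formula of $Ax$, or there is a substitution instance $\Delta/B_i$ of a rule in $R$ with $\Delta\subseteq\{B_1,\dots,B_{i-1}\}$. The logic of $S$ is $L(S)=\{A:\ \vdash_S A\}$. $S'$ is a deductive extension of $S$ if $\vdash_S\subseteq\vdash_{S'}$; $S,S'$ are deductively equal ($S\approx S'$) if $\vdash_S=\vdash_{S'}$. A rule $r$ is admissible in $S=\langle Ax,R\rangle$ if $L(\langle Ax,R\cup\{r\}\rangle)=L(S)$; a rule $\Gamma/A$ is derivable in $S$ if $\Gamma\vdash_S A$. $\widetilde{R}(S)$ is the set of all rules admissible in $S$, and the structural completion of $S$ is $\widetilde{S}=\langle Ax,\widetilde{R}(S)\rangle$. $S$ is structurally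 complete if every rule admissible in $S$ is derivable in $S$; it is hereditarily structurally complete if it is structurally complete and every deductive extension of it is structurally complete. A set of rules $R'$ is a relative to $S=\langle Ax,R\rangle$ base of admissible rules if $\langle Ax,R\cup R'\rangle\approx\langle Ax,\widetilde{R}(S)\rangle$. *)

(* Defs.v *)
From mathcomp Require Import all_boot.
From mathcomp Require Import boolp classical_sets cardinality.

Set Implicit Arguments.
Unset Strict Implicit.
Unset Printing Implicit Defensive.

Local Open Scope classical_set_scope.

Record language := Language {
  connective : finType;
  arity : connective -> nat
}.

Inductive formula (L : language) : Type :=
| Var of nat
| App (c : connective L) of {ffun 'I_(arity c) -> formula L}.

Definition substitution (L : language) := nat -> formula L.

Fixpoint subst (L : language) (s : substitution L) (A : formula L) : formula L :=
  match A with
  | Var n => s n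
  | App c args => App [ffun i => subst s (args i)]
  end.

Record rule (L : language) := Rule {
  premises : set (formula L);
  premises_finite : finite_set premises;
  conclusion : formula L
}.

Record deductive_system (L : language) := DeductiveSystem {
  axioms : set (formula L);
  rules : set (rule L);
  axioms_nonempty : axioms !=set0;
  rules_nonempty : rules !=set0
}.

(* The sequence of length n >= 1 in the definition of a derivation is indexed
   here by 'I_n.+1, so its last member is the value at ord_max. *)
Definition derives (L : language) (S : deductive_system L)
    (Gamma : set (formula L)) (A : formula L) : Prop :=
  exists (n : nat) (B : 'I_n.+1 -> formula L),
    B ord_max = A /\
    forall i : 'I_n.+1,
      [\/ Gamma (B i),
          exists2 C, axioms S C & exists s, B i = subst s C
        | exists2 r, rules S r & exists s,
            B i = subst s (conclusion r) /\
            subst s @` premises r `<=` B @` [set j : 'I_n.+1 | (j < i)%N]].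

Definition derivable (L : language) (S : deductive_system L) (r : rule L) :
    Prop :=
  derives S (premises r) (conclusion r).

Definition logic (L : language) (S : deductive_system L) : set (formula L) :=
  [set A | derives S set0 A].

Definition deductive_extension (L : language) (S S' : deductive_system L) :
    Prop :=
  forall Gamma A, finite_set Gamma -> derives S Gamma A -> derives S' Gamma A.

Definition deductively_equal (L : language) (S S' : deductive_system L) :
    Prop :=
  forall Gamma A, finite_set Gamma -> (derives S Gamma A <-> derives S' Gamma A).

Lemma add_rules_nonempty (L : language) (S : deductive_system L)
    (R' : set (rule L)) : rules S `|` R' !=set0.
Proof. by have [r Sr] := rules_nonempty S; exists r; left. Qed.

Definition add_rules (L : language) (S : deductive_system L)
    (R' : set (rule L)) : deductive_system L :=
  DeductiveSystem (axioms_nonempty S) (add_rules_nonempty S R').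

Definition admissible (L : language) (S : deductive_system L) (r : rule L) :
    Prop :=
  logic (add_rules S [set r]) = logic S.

Definition admissible_rules (L : language) (S : deductive_system L) :
    set (rule L) :=
  [set r | admissible S r].

Lemma admissible_rules_nonempty (L : language) (S : deductive_system L) :
  admissible_rules S !=set0.
Proof.
have [r Sr] := rules_nonempty S; exists r => /=.
suff E : add_rules S [set r] = S by rewrite /admissible_rules /= /admissible E.
case: S Sr => Ax R Ax0 R0 /= Rr; rewrite /add_rules.
move: (axioms_nonempty _) (add_rules_nonempty _ _) => /=.
have -> : R `|` [set r] = R by apply/setUidPl => _ ->.
by move=> Ax1 R1; rewrite (Prop_irrelevance Ax1 Ax0) (Prop_irrelevance R1 R0).
Qed.

Definition structural_completion (L : language) (S : deductive_system L) :
    deductive_system L :=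
  DeductiveSystem (axioms_nonempty S) (admissible_rules_nonempty S).

Definition structurally_complete (L : language) (S : deductive_system L) :
    Prop :=
  forall r, admissible S r -> derivable S r.

Definition hereditarily_structurally_complete (L : language)
    (S : deductive_system L) : Prop :=
  structurally_complete S /\
  forall S', deductive_extension S S' -> structurally_complete S'.

Definition relative_base (L : language) (S : deductive_system L)
    (R' : set (rule L)) : Prop :=
  deductively_equal (add_rules S R') (structural_completion S).

(* Main.v *)
Require Import Defs.
From mathcomp Require Import all_boot.
From mathcomp Require Import boolp classical_sets cardinality.

(** A rule is admissible exactly when the logic is closed under its instances,
and a rule all of whose instances are derivable changes nothing when it is
added to the system.  So a deductive extension of the structural completion of
[S] is, up to deductive equality, an extension [S' + Rb] of [S + Rb]; if [Rb] is
admissible in [S'], then [S'] and [S' + Rb] have the same logic, hence the same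
admissible rules, and structural completeness of [S' + Rb] says precisely that
[Rb] is a base relative to [S']. *)

Set Implicit Arguments.
Unset Strict Implicit.
Unset Printing Implicit Defensive.

Local Open Scope classical_set_scope.

Section Derivations.
Variable L : language.
Implicit Types (S : deductive_system L) (Gamma X : set (formula L)).
Implicit Types (A C : formula L) (r : rule L) (s t : substitution L).

(** * Identity and composition of substitutions *)

Lemma subst_Var A : subst (@Var L) A = A.
Proof.
(* Arguments sit inside a finite function, so the recursion is done by hand with [fix] to have a
   hypothesis for each of them. *)
move: A; fix IH 1 => -[n|c args] //=; congr App.
by apply/ffunP => i; rewrite ffunE; apply: IH.
Qed.

Lemma subst_subst s t A :
  subst s (subst t A) = subst (fun n => subst s (t n)) A.
Proof.
move: A; fix IH 1 => -[n|c args] //=; congr App.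
by apply/ffunP => i; rewrite !ffunE; apply: IH.
Qed.

(** * Derivation sequences and their concatenation *)

Definition justified S Gamma X A : Prop :=
  [\/ Gamma A,
      exists2 C, axioms S C & exists s, A = subst s C
    | exists2 r, rules S r & exists s,
        A = subst s (conclusion r) /\ subst s @` premises r `<=` X].

(** This monotonicity lets a step be moved into a longer sequence, where more formulas precede
    it. *)
Lemma justified_sub S Gamma X Y A :
  X `<=` Y -> justified S Gamma X A -> justified S Gamma Y A.
Proof.
move=> XY [?|?|[r Sr [s [-> sX]]]]; [exact: Or31|exact: Or32|apply: Or33].
by exists r => //; exists s; split=> //; apply: subset_trans XY.
Qed.

(** Indexing by [nat] avoids ordinal casts when sequences are joined; values from [n] on are
    irrelevant, and [n = 0] gives the empty sequence. *)
Definition is_derivation S Gamma n (B : nat -> formula L) : Prop :=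
  forall i, (i < n)%N -> justified S Gamma (B @` [set j | (j < i)%N]) (B i).

Lemma derivesP S Gamma A :
  derives S Gamma A <->
  exists n B, is_derivation S Gamma n.+1 B /\ B n = A.
Proof.
split=> [[n [B [BA dB]]]|[n [B [dB BA]]]].
  exists n, (fun i => B (inord i)); split=> [i ltin|]; last first.
    by rewrite -BA; congr B; apply: val_inj; rewrite /= inordK.
  apply: justified_sub (dB (inord i)) => _ [j /= ltji <-].
  by rewrite inordK // in ltji; exists (val j) => //; rewrite inord_val.
exists n, (fun i => B i); split=> // i.
apply: justified_sub (dB i (ltn_ord i)) => _ [j /= ltji <-].
by exists (Ordinal (ltn_trans ltji (ltn_ord i))).
Qed.

Lemma is_derivation_cat S Gamma m n B1 B2 :
  is_derivation S Gamma m B1 -> is_derivation S Gamma n B2 ->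
  is_derivation S Gamma (m + n)
    (fun i => if (i < m)%N then B1 i else B2 (i - m)%N).
Proof.
move=> d1 d2 i ltimn; case: ifPn => [ltim|]; last rewrite -leqNgt => leim.
  apply: justified_sub (d1 i ltim) => _ [j /= ltji <-].
  by exists j => //=; rewrite (ltn_trans ltji ltim).
have ltn2 : (i - m < n)%N by rewrite ltn_subLR.
apply: justified_sub (d2 _ ltn2) => _ [j /= ltji <-].
exists (m + j)%N => /=; first by rewrite -ltn_subRL.
by rewrite ltnNge leq_addr /= addKn.
Qed.

(** Concatenating one derivation per element of [X] gives a single sequence in which all of [X]
    occurs. *)
Lemma derives_finite S Gamma X : finite_set X ->
  (forall A, X A -> derives S Gamma A) ->
  exists n B, is_derivation S Gamma n B /\ X `<=` B @` [set j | (j < n)%N].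
Proof.
(* The classical decidable equality on formulas allows [X] to be listed as a sequence. *)
move=> /(finite_seqP (T := {classic formula L})) [l ->] {X}.
elim: l => [|A l IHl] dl.
  (* The value [Var L 0] is a filler that a sequence of length 0 never reads. *)
  by exists 0%N, (fun=> Var L 0); split=> // A; rewrite /= in_nil.
have [|n [B [dB lB]]] := IHl.
  by move=> C lC; apply: dl; rewrite /= inE lC orbT.
have /derivesP [m [B' [dB' B'A]]] : derives S Gamma A.
  by apply: dl; rewrite /= inE eqxx.
exists (n + m.+1)%N, (fun i => if (i < n)%N then B i else B' (i - n)%N).
split; first exact: is_derivation_cat.
move=> C; rewrite /= inE => /orP [/eqP->|/lB [j /= ltjn <-]].
  exists (n + m)%N; first by rewrite /= ltn_add2l.
  by rewrite ltnNge leq_addr /= addKn.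
by exists j; rewrite /= ?ltjn // ltn_addr.
Qed.

(** Append [A] to a common derivation of all formulas of [X]. *)
Lemma derives_justified S Gamma X A : finite_set X ->
  (forall C, X C -> derives S Gamma C) -> justified S Gamma X A ->
  derives S Gamma A.
Proof.
move=> finX dX jA; have [n [B [dB XB]]] := derives_finite finX dX.
apply/derivesP; exists n, (fun i => if (i < n)%N then B i else A).
split=> [i|]; last by rewrite ltnn.
rewrite ltnS leq_eqVlt => /orP [/eqP->|ltin].
  rewrite ltnn; apply: justified_sub jA => C /XB [j /= ltjn <-].
  by exists j => //=; rewrite ltjn.
rewrite ltin; apply: justified_sub (dB i ltin) => _ [j /= ltji <-].
by exists j => //=; rewrite (ltn_trans ltji ltin).
Qed.

(** * Derivability as an inductively generated closure *)

Lemma derives_hyp S Gamma A : Gamma A -> derives S Gamma A.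
Proof. by move=> GA; apply: (@derives_justified _ _ set0) => //; apply: Or31. Qed.

Lemma derives_axiom S Gamma A s : axioms S A -> derives S Gamma (subst s A).
Proof.
move=> SA; apply: (@derives_justified _ _ set0) => //.
by apply: Or32; exists A => //; exists s.
Qed.

Lemma derives_rule S Gamma r s : rules S r ->
  (forall C, premises r C -> derives S Gamma (subst s C)) ->
  derives S Gamma (subst s (conclusion r)).
Proof.
move=> Sr dr; apply: (@derives_justified _ _ (subst s @` premises r)).
- exact/finite_image/premises_finite.
- by move=> _ [C /dr ? <-].
- by apply: Or33; exists r => //; exists s; split=> // ?.
Qed.

(** Strong induction on positions in the sequence; from here on derivations are handled without
    indices. *)
Lemma derives_ind S Gamma (P : formula L -> Prop) :
  (forall A, Gamma A -> P A) ->
  (forall A s, axioms S A -> P (subst s A)) ->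
  (forall r s, rules S r -> (forall C, premises r C -> P (subst s C)) ->
    P (subst s (conclusion r))) ->
  forall A, derives S Gamma A -> P A.
Proof.
move=> Phyp Pax Prule _ /derivesP [n [B [dB <-]]].
suff PB i : (i < n.+1)%N -> P (B i) by exact: PB.
elim/ltn_ind: i => i IHi ltin.
have [/Phyp //|[C SC [s ->]]|[r Sr [s [-> sX]]]] := dB i ltin; first exact: Pax.
apply: Prule => // C rC.
have [|j /= ltji <-] := sX (subst s C); first by exists C.
by apply: IHi => //; apply: ltn_trans ltin.
Qed.

Lemma derives_cut S Gamma Delta A :
  (forall C, Gamma C -> derives S Delta C) ->
  derives S Gamma A -> derives S Delta A.
Proof.
move=> GD; apply: derives_ind => // [C s|r s]; first exact: derives_axiom.
exact: derives_rule.
Qed.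

Lemma derives_subst S Gamma A s :
  derives S Gamma A -> derives S (subst s @` Gamma) (subst s A).
Proof.
move: A; apply: derives_ind => [A GA|A t SA|r t Sr IH].
- by apply: derives_hyp; exists A.
- by rewrite subst_subst; apply: derives_axiom.
- rewrite subst_subst; apply: derives_rule => // C /IH.
  by rewrite subst_subst.
Qed.

Lemma rule_derivable S r : rules S r -> derivable S r.
Proof.
move=> Sr; rewrite /derivable -(subst_Var (conclusion r)).
by apply: derives_rule => // C rC; rewrite subst_Var; apply: derives_hyp.
Qed.

(** Substituting into the derivation of the rule and cutting its premises lets a derivable rule act
    as a primitive one. *)
Lemma derivable_closed S Gamma r s : derivable S r ->
  (forall C, premises r C -> derives S Gamma (subst s C)) ->
  derives S Gamma (subst s (conclusion r)).
Proof.
move=> /(derives_subst s) dr GP; apply: derives_cut dr.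
by move=> _ [C /GP ? <-].
Qed.

(** * Comparing systems through their axioms and rules *)

Lemma derives_interpret S S' Gamma A :
  axioms S `<=` logic S' -> (forall r, rules S r -> derivable S' r) ->
  derives S Gamma A -> derives S' Gamma A.
Proof.
move=> axS' rS'; apply: derives_ind => [C|C s /axS' dC|r s /rS'].
- exact: derives_hyp.
(* The image of the empty set of hypotheses is empty, so the cut has nothing to discharge. *)
- by apply: derives_cut (derives_subst s dC) => _ [? []].
- exact: derivable_closed.
Qed.

Lemma axioms_logic S : axioms S `<=` logic S.
Proof. by move=> A SA; rewrite -(subst_Var A); apply: derives_axiom. Qed.

Lemma extension_derivable S S' r :
  deductive_extension S S' -> derivable S r -> derivable S' r.
Proof. by move=> SS'; apply/SS'/premises_finite. Qed.

Lemma extension_logic S S' : deductive_extension S S' -> logic S `<=` logic S'.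
Proof. by move=> SS' A; apply: SS'. Qed.

Lemma derives_add_rules S (R : set (rule L)) Gamma A :
  derives S Gamma A -> derives (add_rules S R) Gamma A.
Proof.
apply: derives_interpret => [|r Sr]; first exact: (@axioms_logic (add_rules S R)).
by apply: rule_derivable; left.
Qed.

(** * Admissible rules and the structural completion *)

Lemma logic_add_rules S (R : set (rule L)) :
  (forall r s, R r -> (forall C, premises r C -> logic S (subst s C)) ->
    logic S (subst s (conclusion r))) ->
  logic (add_rules S R) = logic S.
Proof.
move=> RS; apply/seteqP; split=> A; last exact: derives_add_rules.
apply: derives_ind => // [C s|r s [Sr|Rr]]; first exact: (@derives_axiom S).
  exact: (@derives_rule S set0).
exact: RS.
Qed.

(** An application of [r] to theorems stays inside the logic of the enlarged system, which is that
    of [S]; conversely, closure is the induction case of the new rule. *)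
Lemma admissibleP S r : admissible S r <->
  (forall s, (forall C, premises r C -> logic S (subst s C)) ->
    logic S (subst s (conclusion r))).
Proof.
split=> [Sr s sr|Sr]; last by apply: logic_add_rules => _ s ->; apply: Sr.
rewrite -Sr; apply: (@derives_rule (add_rules S [set r])); first by right.
by move=> C /sr; apply: derives_add_rules.
Qed.

Lemma derivable_admissible S r : derivable S r -> admissible S r.
Proof. by move=> Sr; apply/admissibleP => s; apply: derivable_closed. Qed.

Lemma admissible_eq_logic S S' r :
  logic S = logic S' -> admissible S r -> admissible S' r.
Proof. by move=> SS' /admissibleP; rewrite SS' => /admissibleP. Qed.

Lemma logic_add_admissible S (R : set (rule L)) :
  (forall r, R r -> admissible S r) -> logic (add_rules S R) = logic S.
Proof. by move=> RS; apply: logic_add_rules => r s /RS/admissibleP; apply. Qed.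

Lemma logic_structural_completion S :
  logic (structural_completion S) = logic S.
Proof.
apply/seteqP; split=> A; apply: derives_ind => // [C s|r s].
- exact: (@derives_axiom S).
- by move=> /admissibleP; apply.
- exact: (@derives_axiom (structural_completion S)).
- move=> Sr; apply: (@derives_rule (structural_completion S)) => /=.
  exact/derivable_admissible/rule_derivable.
Qed.

(** Admissibility depends only on the logic, so a rule admissible in the completion is admissible in
    [S] and hence one of its primitive rules. *)
Lemma structural_completion_complete S :
  structurally_complete (structural_completion S).
Proof.
move=> r /(admissible_eq_logic (logic_structural_completion S)) Sr.
exact: rule_derivable.
Qed.

Lemma structural_completion_extension S :
  deductive_extension S (structural_completion S).
Proof.
move=> Gamma A _; apply: derives_interpret => [|r Sr].
  exact: (@axioms_logic (structural_completion S)).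
by apply: rule_derivable; apply/derivable_admissible/rule_derivable.
Qed.

Lemma add_rules_structural_completion S (R : set (rule L)) :
  (forall r, R r -> admissible S r) ->
  deductive_extension (add_rules S R) (structural_completion S).
Proof.
move=> RS Gamma A _; apply: derives_interpret => [|r rR].
  exact: (@axioms_logic (structural_completion S)).
apply: rule_derivable; case: rR => [Sr|/RS //].
exact/derivable_admissible/rule_derivable.
Qed.

Lemma add_rules_extension S S' (R : set (rule L)) :
  deductive_extension S S' ->
  deductive_extension (add_rules S R) (add_rules S' R).
Proof.
move=> SS' Gamma A _; apply: derives_interpret => [C SC|r [Sr|Rr]].
- exact/derives_add_rules/(extension_logic SS')/axioms_logic.
- exact/derives_add_rules/(extension_derivable SS')/rule_derivable.
- by apply: rule_derivable; right.
Qed.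

Lemma add_derivable_rules S (R : set (rule L)) :
  (forall r, R r -> derivable S r) -> deductive_extension (add_rules S R) S.
Proof.
move=> RS Gamma A _; apply: derives_interpret; first exact: (@axioms_logic S).
by move=> r [/rule_derivable|/RS].
Qed.

End Derivations.

Theorem theorem4p9 (L : language) (S : deductive_system L)
    (Rb : set (rule L)) (hRb : relative_base S Rb) :
  hereditarily_structurally_complete (structural_completion S) <->
  (forall S' : deductive_system L,
     deductive_extension S S' ->
     (forall r : rule L, Rb r -> admissible S' r) ->
     relative_base S' Rb).
Proof.
split=> [[_ hsc] S' SS' RbS'|base].
  have sc : structurally_complete (add_rules S' Rb).
    (* By [hRb], extending the completion of [S] amounts to extending [S] with [Rb] added. *)
    apply: hsc => Gamma A finG /(hRb Gamma A finG).
    exact: add_rules_extension.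
  move=> Gamma A finG; split; first exact: add_rules_structural_completion.
  apply: derives_interpret => [|r S'r]; first exact: (@axioms_logic _ (add_rules S' Rb)).
  (* Adding the admissible [Rb] keeps the logic of [S'], so [r] remains admissible and completeness
     makes it derivable. *)
  by apply/sc/(admissible_eq_logic _ S'r); rewrite logic_add_admissible.
split=> [|S' cSS' r S'r]; first exact: structural_completion_complete.
have RbS' q : Rb q -> derivable S' q.
  (* Rules of [Rb] are primitive in [S] with [Rb] added, so derivable in the completion of [S] and
     then in [S']. *)
  move=> Rbq; apply/(extension_derivable cSS')/hRb; first exact: premises_finite.
  by apply: (@rule_derivable _ (add_rules S Rb)); right.
have SS' : deductive_extension S S'.
  by move=> Gamma A finG /(structural_completion_extension finG); apply: cSS'.
have finr := premises_finite r.
(* The rules of [Rb] can be eliminated from [S'], so it suffices to derive [r] with them; by [base]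
   this is derivability in the completion of [S'], where [r] is primitive. *)
apply: (add_derivable_rules RbS' finr).
apply/(base S' SS' (fun q Rbq => derivable_admissible (RbS' q Rbq)) _ _ finr).
exact: (@rule_derivable _ (structural_completion S')).
Qed.
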